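(* Let $G$ be a graph. For each positive integer $s$ with $1\leq s\leq\omega(G)$, there is a path in $G$ of length at least $\frac{(s+1)N_{s+1}(G)}{N_{s}(G)}+s-1$.
   Context: Graphs are finite and simple. $\omega(G)$ denotes the clique number of $G$, i.e. the size (number of vertices) of a largest clique in $G$. $N_j(G)$ denotes the number of copies of $K_j$ in $G$, i.e. the number of $j$-element vertex subsets inducing a complete graph; in particular $N_1(G)=|V(G)|$, $N_2(G)=|E(G)|$, and $N_j(G)=0$ for $j>\omega(G)$. The length of a path is its number of edges, so a path with $l$ vertices has length $l-1$ (a single vertex is a path of length $0$). *)

(* Defs.v *)
From mathcomp Require Export all_boot all_order all_algebra.

Set Implicit Arguments.
Unset Strict Implicit.
Unset Printing Implicit Defensive.

(* A finite simple graph is a finType of vertices with a symmetric and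
   irreflexive adjacency relation; these two properties are hypotheses of the
   theorem. *)
Definition clique (V : finType) (e : rel V) (A : {set V}) : bool :=
  [forall x in A, forall y in A, (x != y) ==> e x y].

Definition clique_number (V : finType) (e : rel V) : nat :=
  \max_(A : {set V} | clique e A) #|A|.

Definition num_cliques (V : finType) (e : rel V) (j : nat) : nat :=
  #|[set A : {set V} | clique e A & #|A| == j]|.

(* The path with vertex sequence x :: p; it has size p edges. *)
Definition graph_path (V : finType) (e : rel V) (x : V) (p : seq V) : bool :=
  path e x p && uniq (x :: p).

(* Main.v *)
Require Import Defs.
From mathcomp Require Import all_boot all_order all_algebra zify lra.
Set Implicit Arguments.
Unset Strict Implicit.
Unset Printing Implicit Defensive.
Import Order.TTheory GRing.Theory Num.Theory.

(** Let [m] be the number of vertices of a longest path.  The claim is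
    [(s + 1) N_(s+1) + s N_s <= m N_s] ([clique_ratio_bound]), with equality
    for the complete graph on [m] vertices.  It is proved for all vertex sets
    [S] spanning no path on more than [m] vertices, by induction on [#|S|].

    If [#|S| <= m], the inequality is double counting: an [s]-clique extends
    to an [(s+1)]-clique by at most [#|S| - s] vertices ([clique_count_leq]).

    If some [v] in [S] has [d] neighbours in [S] with [2 d < m], delete it.
    The numbers of [(s+1)]- and [s]-cliques through [v] are the numbers of
    [s]- and [(s-1)]-cliques in the neighbourhood of [v], and the double
    counting bound for this set of only [d] vertices shows that the cliques
    lost satisfy the same inequality.

    Otherwise a longest path in [S], with [k <= m] vertices, has both ends of
    degree at least [k / 2], and all their neighbours are on it.  As in Dirac's
    theorem, its vertices can be arranged in a cycle ([crossing_cycle]).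
    A vertex outside the cycle adjacent to it would give a path on [k + 1]
    vertices.  So the cycle spans a union of components of [S] with at most
    [m] vertices; double counting handles it, and induction handles the
    remaining vertices. *)

(** * Counting cliques inside a vertex set *)

Section CliquesIn.
Variables (V : finType) (e : rel V).
Hypotheses (esym : symmetric e) (eirr : irreflexive e).

Definition cliques_in (S : {set V}) (j : nat) : {set {set V}} :=
  [set A : {set V} | [&& A \subset S, clique e A & #|A| == j]].

Definition neighbours (S : {set V}) (v : V) : {set V} := [set u in S | e v u].

Lemma cliqueP (A : {set V}) :
  reflect (forall x y, x \in A -> y \in A -> x != y -> e x y) (clique e A).
Proof.
apply: (iffP forall_inP) => [cA x y xA yA | cA x xA].
  by move/forall_inP: (cA x xA) => /(_ y yA) /implyP.
by apply/forall_inP => y yA; apply/implyP; apply: cA.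
Qed.

Lemma clique_subset (A B : {set V}) : A \subset B -> clique e B -> clique e A.
Proof.
by move=> /subsetP sAB /cliqueP cB; apply/cliqueP => x y /sAB xB /sAB; apply: cB.
Qed.

Lemma card_cliques_through (S : {set V}) v j : v \in S ->
  #|[set B in cliques_in S j.+1 | v \in B]| = #|cliques_in (neighbours S v) j|.
Proof.
move=> vS; have vNA (A : {set V}) : A \subset neighbours S v -> v \notin A.
  by move=> /subsetP sA; apply/negP => /sA; rewrite inE eirr andbF.
rewrite -[RHS](@card_in_imset _ _ (fun A => v |: A)); last first.
  move=> A B; rewrite !inE => /andP[sA _] /andP[sB _] eAB.
  by rewrite -(setU1K (vNA A sA)) eAB (setU1K (vNA B sB)).
apply: eq_card => B; apply/idP/imsetP => [|[A]]; rewrite !inE.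
  case/andP=> /and3P[sBS cB /eqP szB] vB; exists (B :\ v); last by rewrite setD1K.
  rewrite inE (clique_subset (subsetDl _ _) cB) /=.
  move: (cardsD1 v B); rewrite vB szB add1n => -[<-]; rewrite eqxx andbT.
  apply/subsetP => u; rewrite !inE => /andP[uv uB].
  rewrite (subsetP sBS) //=; apply: (cliqueP _ cB) => //.
  by rewrite eq_sym.
case/and3P=> sAN cA /eqP szA ->; rewrite setU11 andbT cardsU1 (vNA A sAN) szA.
rewrite add1n eqxx andbT; apply/andP; split.
  apply/subsetP => u /setU1P[-> //|/(subsetP sAN)].
  by rewrite inE => /andP[].
have vA u : u \in A -> e v u by move/(subsetP sAN); rewrite inE => /andP[].
apply/cliqueP => x y /setU1P[->|xA] /setU1P[->|yA]; rewrite ?eqxx //.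
- by move=> _; apply: vA.
- by move=> _; rewrite esym; apply: vA.
- exact: (cliqueP _ cA).
Qed.

Lemma card_cliques_delete (S : {set V}) v j : v \in S ->
  #|cliques_in S j.+1| =
  (#|cliques_in (S :\ v) j.+1| + #|cliques_in (neighbours S v) j|)%N.
Proof.
move=> vS; rewrite -(card_cliques_through _ vS) addnC.
rewrite -(cardsID [set B : {set V} | v \in B] (cliques_in S j.+1)).
congr (_ + _)%N; apply: eq_card => B; rewrite !inE //.
by rewrite subsetD1; case: (v \in B); rewrite ?andbF ?andbT.
Qed.

(** Pairs of a [(j+1)]-clique and one of its vertices [v] are pairs of [v]
    and a [j]-clique in its neighbourhood; such a [j]-clique avoids [v], and
    each [j]-clique is avoided by [#|S| - j] vertices. *)
Lemma clique_count_leq (S : {set V}) j :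
  (j.+1 * #|cliques_in S j.+1| + j * #|cliques_in S j|
     <= #|S| * #|cliques_in S j|)%N.
Proof.
have incidences i : (i * #|cliques_in S i| =
    \sum_(v in S) #|[set B in cliques_in S i | v \in B]|)%N.
  transitivity (\sum_(B in cliques_in S i) \sum_(v in S | v \in B) 1)%N.
    rewrite mulnC -sum_nat_const; apply: eq_bigr => B.
    rewrite inE => /and3P[/subsetP sBS _ /eqP <-]; rewrite -sum1_card.
    apply: eq_bigl => v; case vB: (v \in B); rewrite ?andbF //.
    by rewrite (sBS v vB).
  rewrite (exchange_big_dep (fun v => v \in S)) /=; last by move=> B v _ /andP[].
  apply: eq_bigr => v vS; rewrite -sum1_card; apply: eq_bigl => B.
  by rewrite !inE vS.
rewrite !incidences -big_split -sum_nat_const /=; apply: leq_sum => v vS.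
rewrite card_cliques_through //.
rewrite -[leqRHS](cardsID [set B : {set V} | v \in B] (cliques_in S j)) addnC.
apply: leq_add; apply: subset_leq_card; apply/subsetP => B; rewrite !inE //.
case/and3P=> /subsetP sB -> ->; rewrite !andbT; apply/andP; split.
  by apply/negP => /sB; rewrite inE eirr andbF.
by apply/subsetP => u /sB; rewrite inE => /andP[].
Qed.

(** A nonempty clique cannot meet both [C] and its complement.  The empty
    clique would be counted twice, whence the successor. *)
Lemma cliques_in_split (S C : {set V}) j : C \subset S ->
  (forall u w, u \in C -> w \in S -> e u w -> w \in C) ->
  #|cliques_in S j.+1| = (#|cliques_in C j.+1| + #|cliques_in (S :\: C) j.+1|)%N.
Proof.
move=> sCS clC; rewrite -(cardsID (powerset C) (cliques_in S j.+1)).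
congr (_ + _)%N; apply: eq_card => B; rewrite !inE.
  case: (boolP (B \subset C)) => [sBC|]; rewrite ?andbF //.
  by rewrite (subset_trans sBC sCS) andbT.
rewrite subsetD; case: (boolP (clique e B)) => [cB|]; rewrite ?andbF //=.
case: eqP => szB; rewrite ?andbF // !andbT.
case: (boolP (B \subset S)) => [/subsetP sBS|]; rewrite ?andbF ?andbT //=.
(* A clique that meets the closed set [C] is contained in it. *)
apply/idP/idP; last first.
  move=> dBC; apply/negP => sBC.
  have /card_gt0P[u uB] : (0 < #|B|)%N by rewrite szB.
  by have := disjointFr dBC uB; rewrite (subsetP sBC).
apply: contraR => /pred0Pn[u /andP[/= uB uC]].
apply/subsetP => w wB; have [<- //|uw] := eqVneq u w.
by apply: (clC u w uC (sBS w wB)); apply: (cliqueP _ cB).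
Qed.

(** * Longest paths *)

Definition path_in (S : {set V}) (q : seq V) : bool :=
  [&& sorted e q, uniq q & all (mem S) q].

Lemma path_in_size (S : {set V}) q : path_in S q -> (size q <= #|S|)%N.
Proof.
case/and3P=> _ uq /allP sq; rewrite cardE; apply: uniq_leq_size => // u /sq.
by rewrite mem_enum.
Qed.

Lemma path_in_subset (S T : {set V}) q : S \subset T -> path_in S q -> path_in T q.
Proof.
move=> /subsetP sST /and3P[sq uq /allP aq]; rewrite /path_in sq uq /=.
by apply/allP => u /aq /sST.
Qed.

Lemma longest_path_exists (S : {set V}) :
  exists2 q, path_in S q & forall r, path_in S r -> (size r <= size q)%N.
Proof.
pose P n := [exists t : n.-tuple V, path_in S t].
have exP : exists n, P n by exists 0; apply/existsP; exists [tuple].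
have ubP n : P n -> (n <= #|S|)%N.
  by case/existsP=> t /path_in_size; rewrite size_tuple.
case: (ex_maxnP exP ubP) => n /existsP[t Pt] maxn; exists t => // r Pr.
by rewrite size_tuple; apply: maxn; apply/existsP; exists (in_tuple r).
Qed.

(** With [u = last x a] and [y = last z b], replacing the edge [u z] of the
    path from [x] to [y] by the chords [x z] and [u y] makes it a cycle. *)
Lemma cycle_of_crossing x a z b :
  path e x (a ++ z :: b) -> e x z -> e (last z b) (last x a) ->
  cycle e (x :: a ++ rev (z :: b)).
Proof.
rewrite cat_path /= => /and3P[xa _ zb] xz yl.
rewrite rcons_cat -rev_cons cat_path xa /=; set l := last x a.
have -> : rev [:: x, z & b] = rev (belast x (z :: rcons b l)).
  by rewrite /= belast_rcons.
have {1}-> : l = last x (z :: rcons b l) by rewrite /= last_rcons.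
rewrite rev_path /= esym xz rcons_path /= esym yl andbT.
by rewrite (@eq_path _ _ e) // => u w; rewrite /= esym.
Qed.

(** By the pigeonhole principle over the [size p] edges of the path, some edge
    has its second vertex adjacent to [x] and its first adjacent to the other
    end. *)
Lemma crossing_cycle (S : {set V}) x p :
  path e x p ->
  {subset neighbours S x <= x :: p} ->
  {subset neighbours S (last x p) <= x :: p} ->
  (size p < #|neighbours S x| + #|neighbours S (last x p)|)%N ->
  exists2 c, perm_eq c (x :: p) & cycle e c.
Proof.
move=> xp Nx Ny dxy; set y := last x p in Ny dxy *.
pose A := [set i : 'I_(size p) | e x (nth x p i)].
pose B := [set i : 'I_(size p) | e y (nth x (x :: p) i)].
have leA : (#|neighbours S x| <= #|A|)%N.
  apply: leq_trans (leq_imset_card (fun i : 'I_(size p) => nth x p i) A).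
  apply: subset_leq_card; apply/subsetP => u uN.
  have xu : e x u by move: uN; rewrite inE => /andP[].
  have up : u \in p.
    by move: (Nx u uN); rewrite inE; case: eqP xu => [->|//]; rewrite eirr.
  have ip : (index u p < size p)%N by rewrite index_mem.
  by apply/imsetP; exists (Ordinal ip); rewrite ?inE /= nth_index.
have leB : (#|neighbours S y| <= #|B|)%N.
  apply: leq_trans (leq_imset_card (fun i : 'I_(size p) => nth x (x :: p) i) B).
  apply: subset_leq_card; apply/subsetP => u uN.
  have yu : e y u by move: uN; rewrite inE => /andP[].
  have uq := Ny u uN.
  have ip : (index u (x :: p) < size p)%N.
    have : (index u (x :: p) <= size p)%N by rewrite -ltnS index_mem.
    rewrite leq_eqVlt => /predU1P[iu|//].
    by move: yu; rewrite -(nth_index x uq) iu -last_nth eirr.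
  by apply/imsetP; exists (Ordinal ip); rewrite ?inE nth_index.
have : (0 < #|A :&: B|)%N.
  have := cardsUI A B; have := max_card (A :|: B); rewrite card_ord.
  by lia.
case/card_gt0P=> i; rewrite !inE => /andP[xi yi].
have pE : p = take i p ++ nth x p i :: drop i.+1 p.
  by rewrite -drop_nth // cat_take_drop.
exists (x :: take i p ++ rev (nth x p i :: drop i.+1 p)).
  by rewrite perm_cons [X in perm_eq _ X]pE perm_cat2l perm_rev.
have lE : last x (take i p) = nth x (x :: p) i.
  case: (i : nat) (ltn_ord i) => [|k] kp; first by rewrite take0.
  by rewrite (last_nth x) size_takel ?(ltnW kp) //= nth_take.
apply: cycle_of_crossing => //; first by rewrite -pE.
rewrite lE; suff <- : y = last (nth x p i) (drop i.+1 p) by [].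
by rewrite /y [X in last _ X = _]pE last_cat.
Qed.

Lemma cycle_extend (S : {set V}) c u w :
  cycle e c -> uniq c -> all (mem S) c -> u \in c -> w \in S -> w \notin c ->
  e u w -> exists2 r, path_in S r & size r = (size c).+1.
Proof.
move=> cc uc ac u_c wS wc uw; have [i r rE] := rot_to u_c.
exists (w :: rot i c); last by rewrite /= size_rot.
rewrite /path_in /= mem_rot wc rot_uniq uc wS /=; apply/andP; split.
  move: cc; rewrite -(rot_cycle i) rE /= rcons_path => /andP[-> _].
  by rewrite esym uw.
by apply/allP => z; rewrite mem_rot => /(allP ac).
Qed.

(** The neighbours of both ends lie on the path, so by [crossing_cycle] its
    vertices form a cycle.  Cutting this cycle next to [u] and prepending an
    outside neighbour of [u] would give a longer path. *)
Lemma longest_path_closed (S : {set V}) q :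
  path_in S q -> (forall r, path_in S r -> (size r <= size q)%N) ->
  (forall v, v \in S -> (size q <= 2 * #|neighbours S v|)%N) ->
  forall u w, u \in q -> w \in S -> e u w -> w \in q.
Proof.
case: q => [|x p] // Pq maxq degS u w uq wS uw.
case/and3P: (Pq) => xp uniq_q aq; rewrite [sorted _ _]/= in xp.
have xS : x \in S by apply: (allP aq); rewrite mem_head.
have yS : last x p \in S by apply: (allP aq); rewrite mem_last.
(* A neighbour of an end outside the path would prolong it. *)
have Nx : {subset neighbours S x <= x :: p}.
  move=> v; rewrite inE => /andP[vS xv]; apply: contraT => vq.
  suff /maxq : path_in S [:: v, x & p] by rewrite /= ltnn.
  apply/and3P; split; first by rewrite /= esym xv.
    by rewrite cons_uniq vq.
  by apply/allP => z /predU1P[-> //|/(allP aq)].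
have Ny : {subset neighbours S (last x p) <= x :: p}.
  move=> v; rewrite inE => /andP[vS yv]; apply: contraT => vq.
  suff /maxq : path_in S (rcons (x :: p) v) by rewrite size_rcons ltnn.
  apply/and3P; split; first by rewrite /= rcons_path xp.
    by rewrite rcons_uniq vq.
  by rewrite all_rcons aq andbT.
have dxy : (size p < #|neighbours S x| + #|neighbours S (last x p)|)%N.
  by have := degS _ xS; have := degS _ yS; rewrite /=; lia.
have [c cq cc] := crossing_cycle xp Nx Ny dxy.
apply: contraT => wq.
have ac : all (mem S) c by rewrite (perm_all _ cq).
have uniq_c : uniq c by rewrite (perm_uniq cq).
have uc : u \in c by rewrite (perm_mem cq).
have wc : w \notin c by rewrite (perm_mem cq).
have [r /maxq] := cycle_extend cc uniq_c ac uc wS wc uw.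
by move=> le_rq r_c; move: le_rq; rewrite r_c (perm_size cq) ltnn.
Qed.

(** * The bound *)

(** The induction passes to subsets of [S], which may contain no cliques of
    the relevant sizes; hence the form without division or subtraction, with
    [m] fixed and not tied to the longest path of [S]. *)
Lemma clique_ratio_bound m s (S : {set V}) :
  (forall q, path_in S q -> (size q <= m)%N) ->
  (s.+2 * #|cliques_in S s.+2| + s.+1 * #|cliques_in S s.+1|
     <= m * #|cliques_in S s.+1|)%N.
Proof.
have [n leSn] := ubnP #|S|; elim: n S leSn => // n IHn S leSn maxS.
have small (C : {set V}) : (#|C| <= m)%N ->
    (s.+2 * #|cliques_in C s.+2| + s.+1 * #|cliques_in C s.+1|
     <= m * #|cliques_in C s.+1|)%N.
  move=> leCm; apply: leq_trans (clique_count_leq _ _) _.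
  by rewrite leq_mul2r leCm orbT.
have [/small //|ltmS] := leqP #|S| m.
case: (boolP [exists v in S, 2 * #|neighbours S v| < m]%N).
  case/exists_inP=> v vS degv; rewrite !(card_cliques_delete _ vS).
  have /IHn : (#|S :\ v| < n)%N by move: leSn; rewrite (cardsD1 v S) vS.
  move=> /(_ (fun q Pq => maxS q (path_in_subset (subsetDl _ _) Pq))).
  have := clique_count_leq (neighbours S v) s.
  move: #|cliques_in _ s.+2| #|cliques_in _ s.+1| #|cliques_in (_ S v) s.+1|.
  move: #|cliques_in _ s| #|neighbours S v| degv => b d degv A B a bound_a IH.
  (* What is needed for the cliques through [v] is
     [(s + 2) a + (s + 1) b <= m b].  Adding [(s + 1) a + s b <= d b],
     [a <= d b] and [b <= b] gives it with [2 d + 1 <= m] in place of [m]. *)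
  have le_a : (a <= d * b)%N by nia.
  have le_m : ((2 * d).+1 * b <= m * b)%N by rewrite leq_mul2r degv orbT.
  by nia.
rewrite negb_exists_in => /forall_inP degS.
have [q Pq maxq] := longest_path_exists S.
have leqm := maxS q Pq; case/and3P: (Pq) => _ uniq_q /allP aq.
pose C := [set u in q].
have sCS : C \subset S by apply/subsetP => u; rewrite inE => /aq.
have szC : #|C| = size q by rewrite cardsE; apply/card_uniqP.
have clC u w : u \in C -> w \in S -> e u w -> w \in C.
  rewrite !inE; apply: longest_path_closed => // v vS.
  by apply: leq_trans leqm _; rewrite leqNgt degS.
have q_gt0 : (0 < size q)%N.
  have /card_gt0P[v vS] : (0 < #|S|)%N by lia.
  by apply: (maxq [:: v]); rewrite /path_in /= vS.
rewrite !(cliques_in_split _ sCS clC).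
have /small : (#|C| <= m)%N by rewrite szC.
have /IHn : (#|S :\: C| < n)%N.
  by rewrite cardsDS // szC; lia.
move=> /(_ (fun r Pr => maxS r (path_in_subset (subsetDl _ _) Pr))).
by lia.
Qed.

Lemma num_cliquesE j : num_cliques e j = #|cliques_in setT j|.
Proof. by apply: eq_card => A; rewrite !inE subsetT. Qed.

Lemma num_cliques_gt0 s : (s <= clique_number e)%N -> (0 < num_cliques e s)%N.
Proof.
have c0 : clique e set0 by apply/cliqueP => x y; rewrite inE.
rewrite /clique_number (bigop.bigmax_eq_arg set0) //.
case: arg_maxnP => // A cA _ leA.
have : (0 < #|[set B : {set V} | B \subset A & #|B| == s]|)%N.
  by rewrite cards_draws bin_gt0.
case/card_gt0P=> B; rewrite inE => /andP[sBA szB].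
by apply/card_gt0P; exists B; rewrite inE szB (clique_subset sBA cA).
Qed.

End CliquesIn.

Local Open Scope ring_scope.

Theorem theorem1p3 (V : finType) (e : rel V) (esym : symmetric e)
    (eirr : irreflexive e) (s : nat) (hs : (1 <= s <= clique_number e)%N) :
  exists (x : V) (p : seq V),
    graph_path e x p /\
    (s.+1)%:R * (num_cliques e s.+1)%:R / (num_cliques e s)%:R + s%:R - 1
      <= (size p)%:R :> rat.
Proof.
case/andP: hs; case: s => // s _ /num_cliques_gt0 Ns_gt0.
have [q Pq maxq] := longest_path_exists e setT.
have := clique_ratio_bound esym eirr s maxq; rewrite -!num_cliquesE => bound.
case: q Pq {maxq} bound => [|x p] Pq bound.
  (* The empty sequence is longest only if there are no vertices. *)
  by move: bound; rewrite mul0n leqn0 addn_eq0 !muln_eq0 (gtn_eqF Ns_gt0) andbF.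
exists x, p; case/and3P: Pq => /= xp uniq_q _; split; first exact/andP.
have N_gt0 : 0 < (num_cliques e s.+1)%:R :> rat by rewrite ltr0n.
rewrite -addrA -lerBrDr ler_pdivrMr //.
have : (s.+2 * num_cliques e s.+2 + s.+1 * num_cliques e s.+1)%:R
       <= ((size p).+1 * num_cliques e s.+1)%:R :> rat by rewrite ler_nat.
by rewrite natrD !natrM -[(size p).+1]addn1 natrD; lra.
Qed.
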